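(* Let $f:(0,\infty)\to\mathbb{R}$ be completely monotone, and for $i\ge 0$ write $f_i(t):=\frac{d^i}{dt^i}f(t)$ (so $f_0=f$). Then $\{f_i\}_{i\ge 0}$ is a log-convex sequence; that is, for every $t\in(0,\infty)$ and every integer $i\ge 1$, $$f_i(t)^2\le f_{i-1}(t)\,f_{i+1}(t).$$
   Context: A function $f$ on $(0,\infty)$ possessing derivatives of all orders is called completely monotone (CM) if its derivatives alternate in sign: for all integers $n\ge 0$ and all $t\in(0,\infty)$, $\frac{d^n}{dt^n}f(t)\ge 0$ when $n$ is even and $\frac{d^n}{dt^n}f(t)\le 0$ when $n$ is odd. A sequence of real numbers $a_0,a_1,a_2,\dots$ (finite or infinite) is called log-convex if $a_i^2\le a_{i-1}a_{i+1}$ for all indices $i$ for which both $a_{i-1}$ and $a_{i+1}$ are terms of the sequence. *)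

(* Defs.v *)
(* Stdlib world: the classical reals, with Coquelicot's derivatives. *)
From Stdlib Require Import Reals Arith.
From Coquelicot Require Import Coquelicot.
Open Scope R_scope.

(* A function on (0, +oo) is encoded as a total function R -> R of which only
   the values at positive points matter: [ex_derive_n f n t] and
   [Derive_n f n t] depend only on f near t, so for 0 < t they do not see the
   values of f outside (0, +oo). [Derive_n] is a total operator, hence the
   separate clause on the existence of all the derivatives. *)
Definition completely_monotone (f : R -> R) : Prop :=
  (forall (n : nat) (t : R), 0 < t -> ex_derive_n f n t) /\
  (forall (n : nat) (t : R), 0 < t ->
     (Nat.Even n -> 0 <= Derive_n f n t) /\
     (Nat.Odd n -> Derive_n f n t <= 0)).

(* Infinite sequences a_0, a_1, ... only. The guard [1 <= i] says that a_{i-1}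
   is a term of the sequence, and keeps the subtraction from truncating. *)
Definition log_convex (a : nat -> R) : Prop :=
  forall i : nat, (1 <= i)%nat -> a i ^ 2 <= a (i - 1)%nat * a (i + 1)%nat.

(* Main.v *)
(** Perturbing [f] by [eps * exp (- t)], one may assume that all the
    [a n = (-1)^n f^(n)] are positive. If [K a_(n+2)^2 <= a_(n+1) a_(n+3)]
    everywhere, then [a_n - K' a_(n+1)^2 / a_(n+2)] with [K' = 1 / (2 - K)] is
    nonincreasing, and it cannot become negative because [a_n] is bounded below;
    hence [K' a_(n+1)^2 <= a_n a_(n+2)]. Starting from [K = 0], the constants
    are [m / (m + 1)], which tend to [1]. *)
Require Import Defs.
From Stdlib Require Import Reals Arith Lra Lia.
From Coquelicot Require Import Coquelicot.
Open Scope R_scope.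

(* The eta-expanded form is the one left by [auto_derive]. *)
Lemma Derive_eta (g : R -> R) (x l : R) :
  is_derive g x l -> Derive (fun y : R => g y) x = l.
Proof. exact (is_derive_unique g x l). Qed.

Lemma nonincreasing_of_derive_le0 (g dg : R -> R) (s t : R) :
  (forall x, s <= x -> is_derive g x (dg x)) ->
  (forall x, s <= x -> dg x <= 0) ->
  s <= t -> g t <= g s.
Proof.
intros Hd Hle Hst.
destruct (MVT_gen g s t dg) as [c [[Hc _] Heq]].
- intros x [Hx _]; apply Hd; rewrite Rmin_left in Hx; lra.
- intros x [Hx _]; rewrite Rmin_left in Hx by lra.
  apply continuity_pt_filterlim, (ex_derive_continuous g).
  exists (dg x); apply Hd, Hx.
- rewrite Rmin_left in Hc by lra.
  specialize (Hle c Hc); nra.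
Qed.

Lemma le_of_le_add_eps_mul (x y c : R) :
  (forall eps, 0 < eps -> x <= y + eps * c) -> x <= y.
Proof.
intros H.
apply Rnot_lt_le; intros Hlt.
assert (Hc := Rabs_pos c).
(* The sign of [c] is unknown; this [eps] keeps [eps * Rabs c] below half of [x - y]. *)
assert (Hd : 0 < (x - y) / (2 * (Rabs c + 1))) by (apply Rdiv_lt_0_compat; lra).
specialize (H _ Hd).
assert (Hm : (x - y) / (2 * (Rabs c + 1)) * (2 * (Rabs c + 1)) = x - y)
  by (field; lra).
assert (Hcc := Rle_abs c).
nra.
Qed.

(** A slope of at most [- c] exhausts the value [g t] by the time [t + g t / c]. *)
Lemma not_pos_of_derive_le_neg (g dg : R -> R) (t c : R) :
  0 < c ->
  (forall x, t <= x -> is_derive g x (dg x)) ->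
  (forall x, t <= x -> dg x <= - c) ->
  ~ (forall x, t <= x -> 0 < g x).
Proof.
intros Hc Hd Hle Hpos.
assert (Hgt := Hpos t (Rle_refl t)).
assert (Hq : 0 < g t / c) by (apply Rdiv_lt_0_compat; lra).
assert (Hmon := nonincreasing_of_derive_le0 (fun x => g x + c * x)
  (fun x => dg x + c) t (t + g t / c)).
assert (HT := Hpos (t + g t / c)).
assert (Hcq : c * (g t / c) = g t) by (field; lra).
enough (g (t + g t / c) + c * (t + g t / c) <= g t + c * t)
  by (specialize (HT ltac:(lra)); nra).
apply Hmon; [| |lra].
- intros x Hx; specialize (Hd x Hx).
  auto_derive; [exists (dg x); exact Hd|].
  rewrite (Derive_eta g x _ Hd); lra.
- intros x Hx; specialize (Hle x Hx); lra.
Qed.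

(** The functions [f], [h], [u], [v] stand for four consecutive [a n]: the inequality with constant
    [K] for the last three is traded for one with [K'] for the first three. *)
Lemma pos_chain_improve (f h u v : R -> R) (K K' : R) :
  (forall x, 0 < x -> is_derive f x (- h x)) ->
  (forall x, 0 < x -> is_derive h x (- u x)) ->
  (forall x, 0 < x -> is_derive u x (- v x)) ->
  (forall x, 0 < x -> 0 < f x) ->
  (forall x, 0 < x -> 0 < h x) ->
  (forall x, 0 < x -> 0 < u x) ->
  0 <= K' <= 1 -> K' * (2 - K) = 1 ->
  (forall x, 0 < x -> K * u x ^ 2 <= h x * v x) ->
  forall t, 0 < t -> K' * h t ^ 2 <= f t * u t.
Proof.
intros Df Dh Du Pf Ph Pu HK' HKK' HK t Ht.
apply Rnot_lt_le; intros Hlt.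
(* [F] is negative exactly where the claim fails. *)
set (F := fun x => f x - K' * (h x ^ 2 / u x)).
assert (HF : F t < 0).
{ unfold F; assert (Hu := Pu t Ht).
  apply (Rmult_lt_reg_r (u t)); [exact Hu|].
  replace ((f t - K' * (h t ^ 2 / u t)) * u t)
    with (f t * u t - K' * h t ^ 2) by (field; lra).
  lra. }
assert (Fmon : forall x, t <= x -> F x <= F t).
{ intros y Hy.
  apply (nonincreasing_of_derive_le0 F
    (fun x => - h x + K' * (2 * h x - h x ^ 2 * v x / u x ^ 2))); [| |exact Hy].
  - intros x Hx; assert (Hx0 : 0 < x) by lra.
    assert (Hu := Pu x Hx0).
    unfold F; auto_derive.
    + repeat split; try lra; eexists; [apply Df|apply Dh|apply Du]; lra.
    + rewrite (Derive_eta f x _ (Df x Hx0)),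
        (Derive_eta h x _ (Dh x Hx0)),
        (Derive_eta u x _ (Du x Hx0)).
      field; lra.
  - intros x Hx; assert (Hx0 : 0 < x) by lra.
    assert (Hu := Pu x Hx0); assert (Hh := Ph x Hx0).
    (* With this bound the derivative of [F] is at most [- h x + K' * (2 - K) * h x], which vanishes
       by the choice of [K']. *)
    assert (HKh : K * h x <= h x ^ 2 * v x / u x ^ 2).
    { apply (Rmult_le_reg_r (u x ^ 2)); [nra|].
      replace (h x ^ 2 * v x / u x ^ 2 * u x ^ 2)
        with (h x * (h x * v x)) by (field; lra).
      rewrite Rmult_assoc, (Rmult_comm K), Rmult_assoc.
      apply Rmult_le_compat_l; [lra|].
      rewrite Rmult_comm; exact (HK x Hx0). }
    nra. }
set (d := - F t).
assert (Hd : 0 < d) by (unfold d; lra).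
(* From [F x <= - d] and [0 < f x], the subtracted term of [F] is at least [d]; then [K' <= 1]
   removes the constant. *)
assert (Hdu : forall x, t <= x -> d * u x <= h x ^ 2).
{ intros x Hx; assert (Hx0 : 0 < x) by lra.
  assert (Hu := Pu x Hx0); assert (Hf := Pf x Hx0).
  assert (Hxd : d <= K' * (h x ^ 2 / u x)).
  { specialize (Fmon x Hx); unfold d, F in *; lra. }
  assert (Hq : h x ^ 2 / u x * u x = h x ^ 2) by (field; lra).
  assert (0 <= h x ^ 2) by apply pow2_ge_0.
  apply Rle_trans with (K' * h x ^ 2); [|nra].
  rewrite <- Hq, <- Rmult_assoc; apply Rmult_le_compat_r; lra. }
(* [d u <= h^2] makes [h exp (- f / d)] nondecreasing, so [h = - f'] stays away
   from [0] and [f] would become negative. *)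
assert (Hmon : forall y, t <= y ->
  h t * exp (- f t / d) <= h y * exp (- f y / d)).
{ intros y Hy.
  apply Ropp_le_cancel.
  apply (nonincreasing_of_derive_le0 (fun x => - (h x * exp (- f x / d)))
    (fun x => - ((h x ^ 2 / d - u x) * exp (- f x / d)))); [| |exact Hy].
  - intros x Hx; assert (Hx0 : 0 < x) by lra.
    auto_derive.
    + repeat split; eexists; [apply Dh|apply Df]; lra.
    + rewrite (Derive_eta f x _ (Df x Hx0)),
        (Derive_eta h x _ (Dh x Hx0)).
      unfold Rdiv; field; lra.
  - intros x Hx; specialize (Hdu x Hx).
    assert (0 < exp (- f x / d)) by apply exp_pos.
    assert (u x <= h x ^ 2 / d).
    { apply (Rmult_le_reg_r d); [lra|].
      replace (h x ^ 2 / d * d) with (h x ^ 2) by (field; lra); lra. }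
    nra. }
apply (not_pos_of_derive_le_neg f (fun x => - h x) t (h t * exp (- f t / d))).
- apply Rmult_lt_0_compat; [apply Ph, Ht|apply exp_pos].
- intros x Hx; apply Df; lra.
- intros x Hx; assert (Hx0 : 0 < x) by lra.
  specialize (Hmon x Hx).
  assert (Hh := Ph x Hx0); assert (Hf := Pf x Hx0).
  assert (exp (- f x / d) < 1).
  { rewrite <- exp_0; apply exp_increasing.
    assert (0 < f x / d) by (apply Rdiv_lt_0_compat; lra).
    unfold Rdiv in *; lra. }
  nra.
- intros x Hx; apply Pf; lra.
Qed.

Lemma pos_chain_log_convex (a : nat -> R -> R) :
  (forall n x, 0 < x -> 0 < a n x) ->
  (forall n x, 0 < x -> is_derive (a n) x (- a (S n) x)) ->
  forall n t, 0 < t -> a (S n) t ^ 2 <= a n t * a (S (S n)) t.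
Proof.
intros Pa Da.
(* The index [n] stays general, since the bound at [n] with [m + 1] comes from the one at [n + 1]
   with [m]. For [K = m / (m + 1)], [1 / (2 - K)] is [(m + 1) / (m + 2)]. *)
assert (Hm : forall m n t, 0 < t ->
  INR m / INR (S m) * a (S n) t ^ 2 <= a n t * a (S (S n)) t).
{ induction m as [|m IH]; intros n t Ht.
  - assert (H0 := Pa n t Ht); assert (H2 := Pa (S (S n)) t Ht).
    simpl INR; unfold Rdiv; rewrite !Rmult_0_l; nra.
  - assert (Hm := pos_INR m).
    rewrite !S_INR.
    apply (pos_chain_improve (a n) (a (S n)) (a (S (S n))) (a (S (S (S n))))
      (INR m / INR (S m))); auto.
    + split; [apply Rlt_le, Rdiv_lt_0_compat; lra|].
      apply (Rmult_le_reg_r (INR m + 1 + 1)); [lra|].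
      unfold Rdiv; rewrite Rmult_assoc, Rinv_l; lra.
    + rewrite S_INR; field; lra. }
intros n t Ht.
(* The constant [m / (m + 1)] falls short of 1 by [1 / (m + 1)], so the error is a small multiple of
   [a (S n) t ^ 2]. *)
apply (le_of_le_add_eps_mul _ _ (a (S n) t ^ 2)); intros eps Heps.
destruct (archimed_cor1 eps Heps) as [N [HN HN0]].
destruct N as [|N]; [lia|].
specialize (Hm N n t Ht).
assert (Hp := pos_INR N).
assert (Hs : INR N / INR (S N) = 1 - / INR (S N)).
{ rewrite S_INR; field; lra. }
rewrite Hs in Hm.
assert (0 <= a (S n) t ^ 2) by apply pow2_ge_0.
nra.
Qed.

Lemma completely_monotone_alternating_nonneg (f : R -> R) (n : nat) (t : R) :
  completely_monotone f -> 0 < t -> 0 <= (-1) ^ n * Derive_n f n t.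
Proof.
intros [_ Hs] Ht.
destruct (Hs n t Ht) as [He Ho].
destruct (Nat.Even_or_Odd n) as [H|H].
- specialize (He H); destruct H as [k ->].
  rewrite pow_1_even; lra.
- specialize (Ho H); destruct H as [k ->].
  replace (2 * k + 1)%nat with (S (2 * k)) in * by lia.
  rewrite pow_1_odd; lra.
Qed.

Theorem lemma2 (f : R -> R) (hf : completely_monotone f) :
  forall t : R, 0 < t -> log_convex (fun i : nat => Derive_n f i t).
Proof.
intros t Ht i Hi.
destruct i as [|n]; [lia|].
replace (S n - 1)%nat with n by lia.
replace (S n + 1)%nat with (S (S n)) by lia.
(* Both sides of the inequality are of even total sign degree, so the signs cancel. *)
set (b := fun (k : nat) (x : R) => (-1) ^ k * Derive_n f k x).
enough (H : b (S n) t ^ 2 <= b n t * b (S (S n)) t).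
{ assert (Hsq : (-1) ^ n * (-1) ^ n = 1).
  { rewrite <- Rpow_mult_distr; replace (-1 * -1) with 1 by lra; apply pow1. }
  replace (Derive_n f (S n) t ^ 2) with (b (S n) t ^ 2).
  - replace (Derive_n f n t * Derive_n f (S (S n)) t)
      with (b n t * b (S (S n)) t); [exact H|].
    transitivity ((-1) ^ n * (-1) ^ n *
      (Derive_n f n t * Derive_n f (S (S n)) t));
      [unfold b; rewrite <- !tech_pow_Rmult; ring|rewrite Hsq; ring].
  - transitivity ((-1) ^ n * (-1) ^ n * Derive_n f (S n) t ^ 2);
      [unfold b; rewrite <- (tech_pow_Rmult (-1) n); ring|rewrite Hsq; ring]. }
assert (Db : forall k x, 0 < x -> is_derive (b k) x (- b (S k) x)).
{ intros k x Hx; unfold b.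
  assert (He := proj1 hf (S k) x Hx); simpl in He.
  replace (- ((-1) ^ S k * Derive_n f (S k) x))
    with ((-1) ^ k * Derive (Derive_n f k) x) by (simpl; ring).
  apply (is_derive_scal (Derive_n f k)), Derive_correct, He. }
assert (Nb : forall k x, 0 < x -> 0 <= b k x)
  by (intros k x Hx; apply completely_monotone_alternating_nonneg; assumption).
set (E := exp (- t)).
assert (HE : 0 < E) by apply exp_pos.
(* This is the coefficient of [eps] in the perturbed product; the terms [(eps * E) ^ 2] cancel, and
   the cross term of the square is nonnegative. *)
apply (le_of_le_add_eps_mul _ _ (E * (b n t + b (S (S n)) t))).
intros eps Heps.
(* As [exp (- x)] is minus its own derivative, the same summand at every index preserves the chain
   relation while making all terms strictly positive. *)
assert (H := pos_chain_log_convex (fun k x => b k x + eps * exp (- x))).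
assert (Hc : (b (S n) t + eps * E) ^ 2 <=
             (b n t + eps * E) * (b (S (S n)) t + eps * E)).
{ apply H; [| |exact Ht].
  - intros k x Hx; specialize (Nb k x Hx).
    assert (0 < exp (- x)) by apply exp_pos; nra.
  - intros k x Hx; specialize (Db k x Hx).
    auto_derive; [eexists; exact Db|].
    rewrite (Derive_eta (b k) x _ Db); ring. }
assert (H1 := Nb (S n) t Ht).
assert (0 < eps * E) by (apply Rmult_lt_0_compat; assumption).
nra.
Qed.
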